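(* Let $D$ be a finite-dimensional division algebra over $\mathbb{Q}$, let $\mathcal{O}\subseteq D$ be an order, and let $G_0$ be a finite subgroup of the multiplicative group $D^{*}$ with $G_0\subseteq\mathcal{O}$. Put $d=2\dim_{\mathbb{Q}}D$. Then there exists a lattice packing in $\mathbb{R}^{d}$ (with its standard Euclidean structure) whose packing efficiency is at least $2^{-d}\,\#G_0$. Equivalently, $c_d\ge \#G_0$.
   Context: An order of $D$ is an additive subgroup $\mathcal{O}\subseteq D$ that is a finitely generated $\mathbb{Z}$-module, satisfies $\mathbb{Q}\otimes_{\mathbb{Z}}\mathcal{O}=D$, is closed under multiplication and contains $1_D$. A lattice in a $d$-dimensional real inner product space $V$ is a discrete subgroup $\Lambda$ with $V/\Lambda$ of finite volume (its covolume). For a lattice $\Lambda$ and $r>0$ such that the open balls $B_r(v)$, $v\in\Lambda$, are pairwise disjoint, this collection of balls is a lattice packing, and its packing efficiency is $\mu(B_r(0))/\mathrm{covol}(\Lambda)$, where $\mu$ is Lebesgue measure. The constant $c_d$ is defined as $c_d=\sup\{\mu(gB_r(0)) : r>0,\ g\in SL_d(\mathbb{R}),\ gB_r(0)\cap\mathbb{Z}^d=\{0\}\}$; the best lattice packing density in dimension $d$ equals $2^{-d}c_d$. *)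

(* Defs.v *)
From HB Require Import structures.
From mathcomp Require Import all_boot all_order all_algebra all_field.
From mathcomp Require Import finmap.
From mathcomp Require Import all_classical all_reals all_analysis.

Set Implicit Arguments.
Unset Strict Implicit.
Unset Printing Implicit Defensive.

Import Order.TTheory GRing.Theory Num.Theory.
Import numFieldNormedType.Exports.

Local Open Scope classical_set_scope.
Local Open Scope ring_scope.

Definition is_division_algebra (D : falgType rat) : Prop :=
  forall x : D, x != 0 -> x \is a GRing.unit.

Definition finitely_generated (V : zmodType) (S : {pred V}) : Prop :=
  exists (m : nat) (s : m.-tuple V), forall x, x \in S <-> inIntSpan s x.

(* Surjectivity of Q (x) S -> V; its injectivity is automatic, V being
   torsion-free and Q flat over Z. *)
Definition rationally_full (V : lmodType rat) (S : {pred V}) : Prop :=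
  forall x : V, exists (m : nat) (a : 'I_m -> rat) (y : 'I_m -> V),
    (forall i, y i \in S) /\ x = \sum_(i < m) a i *: y i.

Definition is_order (D : falgType rat) (O : {pred D}) : Prop :=
  [/\ GRing.subring_closed O, finitely_generated O & rationally_full O].

Definition finite_unit_subgroup (D : falgType rat) (G : {fset D}) : Prop :=
  GRing.divr_closed (mem G) /\ (forall g, g \in G -> g \is a GRing.unit).

Section lebesgue_tuple.
Variable R : realType.
Local Notation mR := (measurableTypeR R).

Section step.
Variables (n : nat) (m : {sigma_finite_measure set (n.-tuple mR) -> \bar R}).

Definition tuple_of_pair (p : mR * n.-tuple mR) : n.+1.-tuple mR :=
  [the n.+1.-tuple mR of p.1 :: p.2].

Definition pair_of_tuple (t : n.+1.-tuple mR) : mR * n.-tuple mR :=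
  (tnth t ord0, [tuple of behead t]).

Lemma measurable_tuple_of_pair : measurable_fun [set: _] tuple_of_pair.
Proof. exact: measurable_cons. Qed.

Lemma measurable_pair_of_tuple : measurable_fun [set: _] pair_of_tuple.
Proof.
apply: measurable_fun_pair; first exact: measurable_tnth.
exact: measurable_behead.
Qed.

Lemma tuple_of_pairK : cancel tuple_of_pair pair_of_tuple.
Proof.
by move=> [x t]; rewrite /pair_of_tuple; congr pair; exact/val_inj.
Qed.

Definition lebesgue_step : set (n.+1.-tuple mR) -> \bar R :=
  pushforward (@lebesgue_measure R \x m)%E tuple_of_pair.

Let lebesgue_step0 : lebesgue_step set0 = 0%E.
Proof. by rewrite /lebesgue_step /pushforward preimage_set0 measure0. Qed.

Let lebesgue_step_ge0 A : (0 <= lebesgue_step A)%E.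
Proof. by rewrite /lebesgue_step /pushforward measure_ge0. Qed.

Let lebesgue_step_additive : semi_sigma_additive lebesgue_step.
Proof.
move=> F mF tF mUF; rewrite /lebesgue_step /pushforward preimage_bigcup.
apply: measure_semi_sigma_additive.
- by move=> k; rewrite -[X in measurable X]setTI; exact: measurable_tuple_of_pair.
- apply/trivIsetP => /= i j _ _ ij; rewrite -preimage_setI.
  by move/trivIsetP : tF => /(_ _ _ _ _ ij) ->//; rewrite preimage_set0.
- rewrite -preimage_bigcup -[X in measurable X]setTI.
  exact: measurable_tuple_of_pair.
Qed.

HB.instance Definition _ := isMeasure.Build _ _ _
  lebesgue_step lebesgue_step0 lebesgue_step_ge0 lebesgue_step_additive.

Let lebesgue_step_sigma_finite : sigma_finite [set: _] lebesgue_step.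
Proof.
have /sigma_finiteP[F [FT ndF Foo]] := sigma_finiteT (@lebesgue_measure R).
have /sigma_finiteP[G [GT ndG Goo]] := sigma_finiteT m.
exists (fun k => pair_of_tuple @^-1` (F k `*` G k)).
  rewrite -preimage_bigcup (_ : \bigcup_k _ = [set: _]) ?preimage_setT //.
  apply/seteqP; split=> // -[x t] _.
  have [i _ Fx] : (\bigcup_k F k) x by rewrite -FT.
  have [j _ Gt] : (\bigcup_k G k) t by rewrite -GT.
  exists (maxn i j) => //; split=> /=.
  - by move: x Fx; exact/subsetPset/ndF/leq_maxl.
  - by move: t Gt; exact/subsetPset/ndG/leq_maxr.
move=> k; have [mF Fk] := Foo k; have [mG Gk] := Goo k; split.
  rewrite -[X in measurable X]setTI; apply: measurable_pair_of_tuple => //.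
  exact: measurableX.
rewrite /lebesgue_step /pushforward -comp_preimage.
rewrite (_ : _ \o _ = id); last exact/funext/tuple_of_pairK.
by rewrite preimage_id product_measure1E// lte_mul_pinfty// ge0_fin_numE.
Qed.

HB.instance Definition _ := @Measure_isSigmaFinite.Build _ _ _
  lebesgue_step lebesgue_step_sigma_finite.

End step.

(* The n-fold product of the Lebesgue measure of R, on the product (= Borel)
   sigma-algebra of n.-tuple R. *)
Fixpoint lebesgue_tuple (n : nat) :
    {sigma_finite_measure set (n.-tuple mR) -> \bar R} :=
  match n with
  | 0 => [the {sigma_finite_measure set (0.-tuple mR) -> \bar R}
            of \d_([tuple] : 0.-tuple mR)]
  | n'.+1 => [the {sigma_finite_measure set (n'.+1.-tuple mR) -> \bar R}
            of lebesgue_step (lebesgue_tuple n')]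
  end.

Lemma lebesgue_tuple_box n (A : 'I_n -> set mR) :
  (forall i, measurable (A i)) ->
  lebesgue_tuple n [set t | forall i, A i (tnth t i)] =
  (\prod_(i < n) lebesgue_measure (A i))%E.
Proof.
elim: n A => [|n IHn] A mA.
  by rewrite big_ord0 /= diracE mem_set // => -[].
rewrite big_ord_recl -IHn; last by move=> i; exact: mA.
rewrite /= /lebesgue_step /pushforward -product_measure1E //; last first.
  rewrite (_ : mkset _ = \bigcap_(i in [set: 'I_n])
             (fun t : n.-tuple mR => tnth t i) @^-1` A (lift ord0 i)).
    apply: fin_bigcap_measurable => //.
    move=> i _; rewrite -[X in measurable X]setTI.
    exact: measurable_tnth.
  by apply/seteqP; split=> t /= tA i => [_|]; exact: tA.
congr product_measure1; apply/seteqP; split=> -[x t] /=.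
  move=> xtA; split; first exact: (xtA ord0).
  by move=> i; have := xtA (lift ord0 i); rewrite tnthS.
move=> [Ax tA] i; case: (unliftP ord0 i) => [j|] -> //.
by rewrite tnthS; exact: tA.
Qed.

End lebesgue_tuple.

Section lattice_packing.
Variables (R : realType) (n : nat).
Implicit Types (A F L : set 'cV[R]_n) (r : R) (x v : 'cV[R]_n).

(* Column vectors carry no measurable structure in the library: transport the
   one of n.-tuple R along the coordinates. *)
Definition tuples_in A : set (n.-tuple (measurableTypeR R)) :=
  [set t | A (\col_i tnth t i)].

Definition borel A : Prop := measurable (tuples_in A).

Definition volume A : \bar R := lebesgue_tuple R n (tuples_in A).

(* The norm that the library puts on matrices is the sup norm, hence an explicit
   definition of the Euclidean one. *)
Definition enorm x : R := Num.sqrt (\sum_i x i 0 ^+ 2).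

Definition open_ball v r : set 'cV[R]_n := [set x | enorm (x - v) < r].

Definition fundamental_domain L F : Prop :=
  borel F /\ (forall x, exists! v, L v /\ F (x - v)).

(* A discrete L is countable, so that all its fundamental domains have the same
   volume and the infimum is merely a way of naming it; it is +oo if there is no
   fundamental domain. *)
Definition covolume L : \bar R :=
  ereal_inf [set volume F | F in fundamental_domain L].

Definition is_lattice L : Prop :=
  [/\ zmod_closed (mem L), L `<=` isolated L & (covolume L < +oo)%E].

Definition is_lattice_packing L r : Prop :=
  [/\ is_lattice L, 0 < r & trivIset L (fun v => open_ball v r)].

Definition packing_efficiency L r : \bar R :=
  (volume (open_ball 0 r) / covolume L)%E.

Definition integer_points : set 'cV[R]_n :=
  [set x | forall i, x i 0 \is a Num.int].

Definition c_admissible (g : 'M[R]_n) r : Prop :=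
  [/\ 0 < r, \det g = 1 &
     (mulmx g @` open_ball 0 r) `&` integer_points = [set 0]].

Definition c_const : \bar R :=
  ereal_sup [set volume (mulmx p.1 @` open_ball 0 p.2) |
             p in [set p : 'M[R]_n * R | c_admissible p.1 p.2]].

End lattice_packing.

(* Main.v *)
(* The lattices are taken from the family, indexed by [s] in [O / p O],
     L_s = { (eps (x + y s / p), delta y) : x, y in [O] },
   of fixed covolume, in a Euclidean structure invariant under the left
   multiplications by [G0].  Each [L_s] is a left [O]-module, so [G0] acts freely
   on its nonzero vectors, and the short ones come in packets of size #[G0].

   If [y] acts bijectively on [O / p O], a vector (z, y) of the overlattice
   (eps / p) [O] x delta [O] lies in exactly one [L_s]; for [eps] large there are
   no short nonzero vectors with [y = 0].  Hence the average over [s] of the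
   number of short vectors of [L_s] is, up to [p ^ m], a number of points of
   the overlattice in a ball, bounded by the volume of a slightly larger ball when
   the cells of the overlattice are small.  Counting only the vectors that are
   not twice a lattice vector gains a factor 1 - 2 ^ - d, which absorbs that
   enlargement: a ball of volume exactly #[G0] has, for some [s], fewer than
   #[G0] such vectors, hence none.

   Cholesky factorization of the invariant form makes all generator matrices
   triangular, so that only the volume scaling of triangular maps is needed. *)

Require Import Defs.
From HB Require Import structures.
From mathcomp Require Import all_boot all_order all_algebra all_field.
From mathcomp Require Import finmap.
From mathcomp Require Import all_classical all_reals all_analysis.
From mathcomp Require Import measurable_realfun ring lra zify.

Set Implicit Arguments.
Unset Strict Implicit.
Unset Printing Implicit Defensive.

Import Order.TTheory GRing.Theory Num.Theory.
Import numFieldNormedType.Exports.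

Local Open Scope classical_set_scope.
Local Open Scope ring_scope.

(** * Lebesgue measure under triangular maps *)

Section triangular_change_of_variables.
Variable R : realType.
Local Notation mR := (measurableTypeR R).

Lemma measurable_affine (a c : R) :
  measurable_fun [set: mR] ((fun x => a * x + c) : mR -> mR).
Proof. by apply: measurable_funD => //; exact: mulrl_measurable. Qed.

(** By uniqueness of Lebesgue measure: [a] times its pushforward under the affine map has the right
    value on half-open intervals. *)
Lemma lebesgue_measure_affine (a c : R) (A : set mR) : 0 < a -> measurable A ->
  lebesgue_measure ((fun x => a * x + c) @^-1` A) =
  ((a^-1)%:E * lebesgue_measure A)%E.
Proof.
move=> a0 mA; pose f := (fun x => a * x + c) : mR -> mR.
have mf : measurable_fun setT f := measurable_affine a c.
pose m_ := mscale (NngNum (ltW a0)) (pushforward (@lebesgue_measure R) f).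
pose m := m_ mf.
have -> : lebesgue_measure A = (a%:E * lebesgue_measure (f @^-1` A))%E.
  apply: (@lebesgue_measure_unique _ m) => // _ [[u v]] _ <-.
  rewrite [RHS](_ : _ = a%:E * lebesgue_measure (f @^-1` `]u, v]%classic))%E //.
  rewrite (_ : f @^-1` _ = `](u - c) / a, (v - c) / a]%classic); last first.
    apply/seteqP; split => x /=; rewrite !in_itv /= /f;
      by rewrite ltr_pdivrMr// ler_pdivlMr// ltrBlDr lerBrDr [x * a]mulrC.
  rewrite !lebesgue_measure_itv/= !lte_fin ltr_pM2r ?invr_gt0// ltrD2r.
  case: ifP => _; rewrite ?mule0// -EFinM; congr EFin.
  by field; rewrite gt_eqF.
by rewrite muleA -EFinM mulVf ?gt_eqF// mul1e.
Qed.

Definition mx_tuple n (M : 'M[R]_n) (t : n.-tuple mR) : n.-tuple mR :=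
  [tuple \sum_j M i j * tnth t j | i < n].

Lemma measurable_mx_tuple n (M : 'M[R]_n) : measurable_fun setT (mx_tuple M).
Proof.
apply/measurable_fun_tnthP => i.
rewrite (_ : _ \o _ = fun t => \sum_j M i j * tnth t j); last first.
  by apply/funext => t /=; rewrite tnth_mktuple.
apply: measurable_sum => j.
by apply: measurable_funM => //; exact: measurable_tnth.
Qed.

(* Fubini, integrating the first coordinate first: on each of its lines the map
   is affine of slope [M ord0 ord0]. *)
Lemma lebesgue_tuple_triangular n (M : 'M[R]_n) (A : set (n.-tuple mR)) :
  (forall i j : 'I_n, (j < i)%N -> M i j = 0) -> (forall i, 0 < M i i) ->
  measurable A ->
  lebesgue_tuple R n (mx_tuple M @^-1` A) =
  (((\prod_i M i i)^-1)%:E * lebesgue_tuple R n A)%E.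
Proof.
elim: n M A => [|n IH] M A Mt M0 mA.
  rewrite big_ord0 invr1 mul1e; congr (lebesgue_tuple _ _ _).
  by apply/seteqP; split => t /=; rewrite (tuple0 (mx_tuple _ _)) (tuple0 t).
pose N := \matrix_(i, j) M (lift ord0 i) (lift ord0 j).
have Nt (i j : 'I_n) : (j < i)%N -> N i j = 0 by move=> ji; rewrite mxE Mt.
have N0 i : 0 < N i i by rewrite mxE.
have mAp : measurable (@tuple_of_pair R n @^-1` A).
  by rewrite -[X in measurable X]setTI; exact: measurable_tuple_of_pair.
have mMA : measurable (mx_tuple M @^-1` A).
  by rewrite -[X in measurable X]setTI; exact: measurable_mx_tuple.
have mMAp : measurable (@tuple_of_pair R n @^-1` (mx_tuple M @^-1` A)).
  by rewrite -[X in measurable X]setTI; exact: measurable_tuple_of_pair.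
rewrite /= /lebesgue_step /pushforward.
pose lam := @lebesgue_measure R.
pose m := lebesgue_tuple R n.
(* Switch to the iterated integral whose inner measure is that of the first coordinate. *)
have E X : measurable X -> (lam \x m)%E X = (lam \x^ m)%E X.
  by apply: product_measure_unique => //= B C mB mC; exact: product_measure2E.
rewrite !E // /product_measure2 /=.
pose B := @tuple_of_pair R n @^-1` A.
pose g u := lam (ysection B u).
have mg : measurable_fun setT g by exact: measurable_fun_ysection.
pose c t := \sum_(j < n) M ord0 (lift ord0 j) * tnth t j.
have sec t : ysection (@tuple_of_pair R n @^-1` (mx_tuple M @^-1` A)) t =
    (fun x => M ord0 ord0 * x + c t) @^-1` ysection B (mx_tuple N t).
  apply/seteqP; split => x; rewrite /= /ysection /B /= !inE /=;
  (set t1 := mx_tuple M _; set t2 := tuple_of_pair _;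
   suff -> : t1 = t2 by []);
  (apply: eq_from_tnth => i; rewrite tnth_mktuple big_ord_recl /=;
   case: (unliftP ord0 i) => [k|] ->;
   rewrite ?tnthS ?tnth_mktuple /tuple_of_pair /= ?tnth0 ).
  - rewrite Mt // mul0r add0r; apply: eq_bigr => j _.
    by rewrite mxE tnthS.
  - by congr (_ + _); apply: eq_bigr => j _; rewrite tnthS.
  - rewrite Mt // mul0r add0r; apply: eq_bigr => j _.
    by rewrite mxE tnthS.
  - by congr (_ + _); apply: eq_bigr => j _; rewrite tnthS.
have -> : (\int[m]_t (lam \o ysection
      (@tuple_of_pair R n @^-1` (mx_tuple M @^-1` A))) t =
    \int[m]_t (((M ord0 ord0)^-1)%:E * (g \o mx_tuple N) t))%E.
  apply: eq_integral => t _ /=; rewrite sec /lam lebesgue_measure_affine //.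
  exact: measurable_ysection.
rewrite ge0_integralZl //=; last 2 first.
- by apply: measurableT_comp => //; exact: measurable_mx_tuple.
- by rewrite lee_fin invr_ge0 ltW.
have P0 : 0 <= (\prod_i N i i)^-1 by rewrite invr_ge0 prodr_ge0 // => i _; exact: ltW.
have -> : (\int[m]_t g (mx_tuple N t) = ((\prod_i N i i)^-1)%:E * \int[m]_t g t)%E.
  rewrite -[RHS](ge0_integral_mscale _ _ (NngNum P0)) //.
  rewrite -(@ge0_integral_pushforward _ _ _ _ _ (mx_tuple N) _ m setT g) //; last first.
    exact: measurable_mx_tuple.
  apply: eq_measure_integral; first exact: measurable_mx_tuple.
  by move=> ? C mC _; exact: (IH N C Nt N0 mC).
rewrite big_ord_recl /= invfM EFinM muleA; congr (_ * _ * _)%E.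
by congr (_^-1)%:E; apply: eq_bigr => i _; rewrite mxE.
Qed.

End triangular_change_of_variables.

(** * Volumes of boxes and balls *)

Section euclidean_volume.
Variable R : realType.

Definition sqnorm n (x : 'cV[R]_n) : R := \sum_i x i 0 ^+ 2.

Lemma sqnorm_ge0 n (x : 'cV[R]_n) : 0 <= sqnorm x.
Proof. by apply: sumr_ge0 => i _; exact: sqr_ge0. Qed.

Lemma enorm_lt n (x : 'cV[R]_n) (r : R) : 0 < r ->
  (enorm x < r) = (sqnorm x < r ^+ 2).
Proof.
move=> r0; rewrite -[in RHS](sqr_sqrtr (sqnorm_ge0 x)).
by rewrite ltr_pXn2r // nnegrE ?sqrtr_ge0 // ltW.
Qed.

Lemma mem_open_ball0 n (r : R) (x : 'cV[R]_n) : 0 < r ->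
  open_ball 0 r x <-> sqnorm x < r ^+ 2.
Proof. by move=> r0; rewrite /open_ball /= subr0 enorm_lt. Qed.

Lemma sqnormZ n (a : R) (x : 'cV[R]_n) : sqnorm (a *: x) = a ^+ 2 * sqnorm x.
Proof.
by rewrite /sqnorm mulr_sumr; apply: eq_bigr => i _; rewrite mxE exprMn.
Qed.

(** In each coordinate the two sides differ by a square. The weights are sharp when [sqnorm y] is
    [t ^+ 2 * sqnorm x], so this serves as a triangle inequality for radii [r] and [t * r] with no
    loss. *)
Lemma sqnormD_le n (t : R) (x y : 'cV[R]_n) : 0 < t ->
  sqnorm (x + y) <= (1 + t) * sqnorm x + (1 + t^-1) * sqnorm y.
Proof.
move=> t0; rewrite /sqnorm !mulr_sumr -big_split /=; apply: ler_sum => i _.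
rewrite mxE; set a := x i 0; set b := y i 0.
have -> : (1 + t) * a ^+ 2 + (1 + t^-1) * b ^+ 2 =
    (a + b) ^+ 2 + t^-1 * (t * a - b) ^+ 2 by field; rewrite gt_eqF.
by rewrite lerDl mulr_ge0 ?sqr_ge0 // invr_ge0 ltW.
Qed.

Lemma sqr_coord_le n (x : 'cV[R]_n) i : x i 0 ^+ 2 <= sqnorm x.
Proof.
by rewrite /sqnorm (bigD1 i) //= lerDl; apply: sumr_ge0 => j _; exact: sqr_ge0.
Qed.

Lemma sqnorm_eq0 n (x : 'cV[R]_n) : sqnorm x = 0 -> x = 0.
Proof.
move=> x0; apply/matrixP => i j; rewrite ord1 mxE; apply/eqP.
by rewrite -sqrf_eq0 eq_le sqr_ge0 andbT -x0 sqr_coord_le.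
Qed.

Lemma tuples_in_mulmx n (M : 'M[R]_n) (A : set 'cV[R]_n) :
  tuples_in (mulmx M @^-1` A) = mx_tuple M @^-1` tuples_in A.
Proof.
apply/seteqP; split => t; rewrite /tuples_in /=;
  (set x := (X in A X); set y := (X in _ -> A X); suff -> : x = y by []);
  by apply/matrixP => i j; rewrite !mxE ?tnth_mktuple;
     apply: eq_bigr => k _; rewrite mxE.
Qed.

Lemma borel_mulmx n (M : 'M[R]_n) (A : set 'cV[R]_n) :
  borel A -> borel (mulmx M @^-1` A).
Proof.
move=> mA; rewrite /borel tuples_in_mulmx -[X in measurable X]setTI.
exact: measurable_mx_tuple.
Qed.

Definition upper_triangular n (M : 'M[R]_n) : Prop :=
  (forall i j : 'I_n, (j < i)%N -> M i j = 0) /\ (forall i, 0 < M i i).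

Lemma det_upper_triangular n (M : 'M[R]_n) :
  upper_triangular M -> \det M = \prod_i M i i.
Proof.
move=> [Mt _]; rewrite -det_tr det_trig; last first.
  by apply/is_trig_mxP => i j ij; rewrite mxE Mt.
by apply: eq_bigr => i _; rewrite mxE.
Qed.

Lemma det_upper_triangular_gt0 n (M : 'M[R]_n) :
  upper_triangular M -> 0 < \det M.
Proof.
by move=> Mt; rewrite det_upper_triangular //; apply: prodr_gt0 => i _; case: Mt.
Qed.

Lemma volume_upper_triangular n (M : 'M[R]_n) (A : set 'cV[R]_n) :
  upper_triangular M -> borel A ->
  volume (mulmx M @^-1` A) = ((\det M)^-1%:E * volume A)%E.
Proof.
move=> Mt mA; rewrite /volume tuples_in_mulmx det_upper_triangular //.
by apply: lebesgue_tuple_triangular => //; case: Mt.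
Qed.

Definition box n (A : 'I_n -> set R) : set 'cV[R]_n :=
  [set x | forall i, A i (x i 0)].

Lemma tuples_in_box n (A : 'I_n -> set R) :
  tuples_in (box A) = [set t | forall i, A i (tnth t i)].
Proof.
by apply/seteqP; split => t /= + i => /(_ i); rewrite mxE.
Qed.

Lemma borel_box n (A : 'I_n -> set (measurableTypeR R)) :
  (forall i, measurable (A i)) -> borel (box A).
Proof.
move=> mA; rewrite /borel tuples_in_box.
rewrite (_ : mkset _ = \bigcap_(i in [set: 'I_n])
    (fun t : n.-tuple (measurableTypeR R) => tnth t i) @^-1` A i).
  apply: fin_bigcap_measurable => // i _.
  by rewrite -[X in measurable X]setTI; exact: measurable_tnth.
by apply/seteqP; split=> t /= tA i => [_|]; exact: tA.
Qed.

Lemma volume_box n (A : 'I_n -> set (measurableTypeR R)) :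
  (forall i, measurable (A i)) ->
  volume (box A) = (\prod_(i < n) lebesgue_measure (A i))%E.
Proof. by move=> mA; rewrite /volume tuples_in_box lebesgue_tuple_box. Qed.

Lemma volume_itv_box n (x : 'cV[R]_n) (a : R) : 0 < a ->
  volume (box (fun i => `[x i 0, x i 0 + a[%classic)) = (a ^+ n)%:E.
Proof.
move=> a0; rewrite volume_box; last by move=> i; exact: measurable_itv.
under eq_bigr => i _.
  rewrite lebesgue_measure_itv /= lte_fin ltrDl a0 -EFinD addrC addKr.
  over.
by rewrite prodEFin prodr_const card_ord.
Qed.

Lemma volume_le n (A B : set 'cV[R]_n) :
  borel A -> borel B -> A `<=` B -> (volume A <= volume B)%E.
Proof.
by move=> mA mB AB; apply: le_measure; rewrite ?inE // => t; exact: AB.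
Qed.

Lemma borel_open_ball n (r : R) : 0 < r -> borel (open_ball (0 : 'cV[R]_n) r).
Proof.
move=> r0; rewrite /borel.
pose g (t : n.-tuple (measurableTypeR R)) : measurableTypeR R :=
  \sum_i tnth t i ^+ 2.
have mg : measurable_fun setT g.
  apply: measurable_sum => i.
  by apply: measurable_funX; exact: measurable_tnth.
rewrite (_ : tuples_in _ = g @^-1` `]-oo, r ^+ 2[%classic).
  by rewrite -[X in measurable X]setTI; apply: mg => //; exact: measurable_itv.
apply/seteqP; split => t /=; rewrite in_itv /= => H.
- move/mem_open_ball0 : H => /(_ r0); rewrite /sqnorm /g.
  by under eq_bigr do rewrite mxE.
- apply/mem_open_ball0 => //; move: H; rewrite /sqnorm /g.
  by under [in X in _ -> X]eq_bigr do rewrite mxE.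
Qed.

Lemma volume_ball_scale n (r a : R) : 0 < r -> 0 < a ->
  volume (open_ball (0 : 'cV[R]_n) (a * r)) =
  ((a ^+ n)%:E * volume (open_ball (0 : 'cV[R]_n) r))%E.
Proof.
move=> r0 a0; have ar0 : 0 < a * r by rewrite mulr_gt0.
have Mt : upper_triangular (a%:M : 'M[R]_n).
  by split=> [i j ji|i]; rewrite mxE ?eqxx // eq_sym -val_eqE ltn_eqF.
have -> : open_ball 0 r = mulmx (a%:M : 'M[R]_n) @^-1` open_ball 0 (a * r).
  apply/seteqP; split => x /mem_open_ball0 => /(_ _) H.
  - apply/mem_open_ball0 => //; rewrite mul_scalar_mx sqnormZ exprMn.
    by rewrite ltr_pM2l ?exprn_gt0 //; exact: H.
  - apply/mem_open_ball0 => //; move: (H ar0); rewrite mul_scalar_mx sqnormZ exprMn.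
    by rewrite ltr_pM2l ?exprn_gt0.
rewrite volume_upper_triangular //; last exact: borel_open_ball.
by rewrite det_scalar muleA -EFinM divff ?mul1e // expf_neq0 ?gt_eqF.
Qed.

(** The ball contains a cube of side [r / n.+1%:R] and lies in one of side [r + r]. *)
Lemma volume_ball_fin n (r : R) : 0 < r ->
  exists2 v : R, 0 < v & volume (open_ball (0 : 'cV[R]_n) r) = v%:E.
Proof.
move=> r0; set V := volume _.
have Vle : (V <= ((r + r) ^+ n)%:E)%E.
  rewrite -(volume_itv_box (const_mx (- r))) ?addr_gt0 //.
  apply: volume_le; first exact: borel_open_ball.
    by apply: borel_box => i; exact: measurable_itv.
  move=> x /(mem_open_ball0 _ r0) xr i /=; rewrite in_itv /= mxE addKr.
  have := le_lt_trans (sqr_coord_le x i) xr.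
  rewrite -(real_normK (num_real (x i 0))) ltr_pXn2r ?nnegrE ?normr_ge0 ?(ltW r0) //.
  by rewrite ltr_norml => /andP[/ltW -> ->].
have Vge : (((r / n.+1%:R) ^+ n)%:E <= V)%E.
  (* With [n.+1] in place of [n], the bound [n / n.+1 ^ 2 < 1] is strict and also covers [n = 0]. *)
  have c0 : 0 < r / n.+1%:R by rewrite divr_gt0 ?ltr0n.
  rewrite -(volume_itv_box 0) //.
  apply: volume_le; last 2 first.
  - exact: borel_open_ball.
  - move=> x xb; apply/mem_open_ball0 => //.
    have xi i : x i 0 ^+ 2 <= (r / n.+1%:R) ^+ 2.
      have := xb i; rewrite /= in_itv /= mxE add0r => /andP[x0 /ltW xc].
      by rewrite ler_pXn2r ?nnegrE // ltW.
    apply: le_lt_trans (_ : \sum_(i < n) (r / n.+1%:R) ^+ 2 < _).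
      by apply: ler_sum => i _; exact: xi.
    rewrite sumr_const card_ord exprMn -mulrnAr gtr_pMr ?exprn_gt0 //.
    rewrite -mulr_natl exprVn ltr_pdivrMr ?exprn_gt0 ?ltr0n // mul1r -natrX ltr_nat.
    by rewrite expnS expn1 mulSn ltn_addr.
  by apply: borel_box => i; exact: measurable_itv.
have Vf : V \is a fin_num.
  rewrite ge0_fin_numE; first by rewrite (le_lt_trans Vle) // ltry.
  exact: measure_ge0.
exists (fine V); last by rewrite fineK.
rewrite fine_gt0 // (lt_le_trans _ Vge) ?(le_lt_trans Vle) ?ltry //.
by rewrite lte_fin exprn_gt0 // divr_gt0 // ltr0n.
Qed.

(** Scale the unit ball by an [n]-th root; in dimension 0 every ball has volume 1. *)
Lemma exists_ball_volume n (v : R) : (0 < n)%N -> 0 < v ->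
  exists2 r : R, 0 < r & volume (open_ball (0 : 'cV[R]_n) r) = v%:E.
Proof.
move=> n0 v0; have [w w0 wE] := volume_ball_fin n ltr01.
pose a := (v / w) `^ (n%:R^-1).
have a0 : 0 < a by rewrite powR_gt0 // divr_gt0.
have an : a ^+ n = v / w.
  rewrite -powR_mulrn ?ltW // -powRrM mulVf ?pnatr_eq0 -?lt0n //.
  by rewrite powRr1 // ltW // divr_gt0.
exists a => //; rewrite -[a]mulr1 volume_ball_scale // wE -EFinM an.
by rewrite divfK // gt_eqF.
Qed.

End euclidean_volume.

(** * Counting lattice points in a ball *)

Section lattice_point_count.
Variables (R : realType) (n : nat).
Local Notation real_mx := (map_mx (intr : int -> R)).

Definition even_vector (w : 'cV[int]_n) : bool := [forall i, (2 %| w i 0%R)%Z].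

Lemma intr_itv_eq (a b : int) (x : R) : ((2 %| a)%Z = (2 %| b)%Z) ->
  a%:~R <= x < a%:~R + 2 -> b%:~R <= x < b%:~R + 2 -> a = b.
Proof.
move=> ab /andP[ax xa] /andP[bx xb].
have : a%:~R < b%:~R + 2 :> R := le_lt_trans ax xb.
have : b%:~R < a%:~R + 2 :> R := le_lt_trans bx xa.
rewrite -[2](intrD R 1 1) -!intrD !ltr_int.
move: ab; lia.
Qed.

(** Side 2 rather than 1: the cells of a single class modulo 2 are already disjoint, so each class
    is bounded separately and leaving one class out gains something. *)
Let cell (w : 'cV[int]_n) : set 'cV[R]_n :=
  box (fun i => `[real_mx w i 0, real_mx w i 0 + 2[%classic).

Let parity (w : 'cV[int]_n) : {ffun 'I_n -> bool} :=
  [ffun i => (2 %| w i 0%R)%Z].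

Lemma cell_disjoint (w w' : 'cV[int]_n) (x : 'cV[R]_n) :
  parity w = parity w' -> cell w x -> cell w' x -> w = w'.
Proof.
move=> ww' wx w'x; apply/matrixP => i j; rewrite ord1.
have := wx i; have := w'x i; rewrite /= !in_itv /= !mxE => w'xi wxi.
apply: (intr_itv_eq _ wxi w'xi).
by have := congr1 (fun f : {ffun _} => f i) ww'; rewrite !ffunE.
Qed.

Variables (M : 'M[R]_n) (r t : R).
Hypotheses (Mt : upper_triangular M) (r0 : 0 < r) (t0 : 0 < t).
Hypothesis cell_small : forall u : 'cV[R]_n, (forall i, 0 <= u i 0 < 2) ->
  sqnorm (M *m u) <= (t * r) ^+ 2.

Lemma cell_sub_ball (w : 'cV[int]_n) : sqnorm (M *m real_mx w) < r ^+ 2 ->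
  cell w `<=` mulmx M @^-1` open_ball 0 ((1 + t) * r).
Proof.
move=> wr x wx /=; apply/mem_open_ball0; first by rewrite mulr_gt0 ?addr_gt0.
have -> : M *m x = M *m real_mx w + M *m (x - real_mx w).
  by rewrite -mulmxDr addrC subrK.
apply: le_lt_trans (sqnormD_le _ _ t0) _.
have xw : sqnorm (M *m (x - real_mx w)) <= (t * r) ^+ 2.
  apply: cell_small => i; have := wx i; rewrite /= in_itv /= !mxE.
  by rewrite subr_ge0 ltrBlDl.
have -> : ((1 + t) * r) ^+ 2 = (1 + t) * r ^+ 2 + (1 + t^-1) * (t * r) ^+ 2.
  by field; rewrite gt_eqF.
apply: ltr_leD; first by rewrite ltr_pM2l ?addr_gt0.
by rewrite ler_pM2l // addr_gt0 // invr_gt0.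
Qed.

Variables (J : finType) (f : J -> 'cV[int]_n) (v : R).
Hypothesis f_inj : injective f.
Hypothesis f_short : forall j, sqnorm (M *m real_mx (f j)) < r ^+ 2.
Hypothesis vE : volume (open_ball (0 : 'cV[R]_n) r) = v%:E.

(** The cells of the class are disjoint, have volume [2 ^+ n] each, and lie in the preimage under
    [M] of the ball enlarged by the factor [1 + t]. *)
Lemma parity_class_count (c : {ffun 'I_n -> bool}) :
  #|[pred j | parity (f j) == c]|%:R * (2 ^+ n * \det M) <= (1 + t) ^+ n * v.
Proof.
pose s := enum [pred j | parity (f j) == c].
have mcell j : measurable (tuples_in (cell (f j))).
  by apply: borel_box => i; exact: measurable_itv.
have tcell : trivIset [set` s] (fun j => tuples_in (cell (f j))).
  move=> j k; rewrite /= !mem_enum !inE => /eqP jc /eqP kc [x [xj xk]].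
  by apply: f_inj; apply: cell_disjoint xj xk; rewrite jc kc.
have fs : finite_set [set` s] by exact: finite_seq.
have := @le_measure _ _ _ (lebesgue_tuple R n)
  (\bigcup_(j in [set` s]) tuples_in (cell (f j)))
  (tuples_in (mulmx M @^-1` open_ball 0 ((1 + t) * r))).
have r1 : 0 < (1 + t) * r by rewrite mulr_gt0 ?addr_gt0.
have mB : borel (mulmx M @^-1` open_ball 0 ((1 + t) * r)).
  by apply: borel_mulmx; exact: borel_open_ball.
rewrite !inE => /(_ (fin_bigcup_measurable fs (fun j _ => mcell j)) mB).
rewrite measure_fin_bigcup //.
rewrite -fsbig_seq ?enum_uniq //.
rewrite -[X in (_ <= X)%E]/(volume (mulmx M @^-1` open_ball 0 ((1 + t) * r))).
rewrite volume_upper_triangular //; last exact: borel_open_ball.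
rewrite volume_ball_scale ?addr_gt0 // vE.
have cellE j : lebesgue_tuple R n (tuples_in (cell (f j))) = (2 ^+ n)%:E.
  exact: volume_itv_box.
rewrite (eq_bigr (fun=> (2 ^+ n)%:E)); last by move=> j _; exact: cellE.
rewrite sumEFin big_const_seq count_predT iter_addr addr0 -cardE -!EFinM.
rewrite lee_fin => H.
have d0 := det_upper_triangular_gt0 Mt.
rewrite mulrA mulr_natl -ler_pdivlMr // mulrC; apply: H.
by move=> x [j _]; apply: cell_sub_ball.
Qed.

(** Sum over the classes modulo 2; the even one is empty, which leaves [2 ^+ n - 1] of them. *)
Lemma nonzero_classes_count :
  (forall j, ~~ even_vector (f j)) ->
  #|J|%:R * (2 ^+ n * \det M) <= (2 ^+ n - 1) * ((1 + t) ^+ n * v).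
Proof.
move=> f_odd; pose e := [ffun=> true] : {ffun 'I_n -> bool}.
have -> : #|J| = (\sum_(c | c != e) #|[pred j | parity (f j) == c]|)%N.
  rewrite -sum1_card (partition_big (parity \o f) (fun c => c != e)) /=.
    by apply: eq_bigr => c _; rewrite sum1_card.
  move=> j _; apply: contra (f_odd j) => /eqP fe; apply/forallP => i.
  by have := congr1 (fun f : {ffun _} => f i) fe; rewrite !ffunE => ->.
rewrite natr_sum mulr_suml.
apply: le_trans (ler_sum _ (fun c _ => parity_class_count c)) _.
rewrite sumr_const cardC1 card_ffun card_bool card_ord.
by rewrite -[leLHS]mulr_natl -subn1 natrB ?expn_gt0 // natrX.
Qed.

End lattice_point_count.

(** * From triangular matrices to packings *)

Section cholesky.
Variable R : realType.

Definition quad_form n (A : 'M[R]_n) (v : 'cV[R]_n) : R := (v^T *m A *m v) 0 0.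

Lemma sqnormE n (v : 'cV[R]_n) : sqnorm v = (v^T *m v) 0 0.
Proof. by rewrite mxE; apply: eq_bigr => i _; rewrite mxE expr2. Qed.

(* Splitting off the first coordinate: the Schur complement [C - b^T b / a] of
   the pivot [a] is again symmetric and positive definite. *)
Lemma cholesky n (A : 'M[R]_n) : A^T = A ->
  (forall v, v != 0 -> 0 < quad_form A v) ->
  exists2 U : 'M[R]_n, upper_triangular U & U^T *m U = A.
Proof.
elim: n A => [|n IH] A As Ap.
  exists 1%:M; last by apply/matrixP => -[].
  by split => -[].
rewrite -[n.+1]/(1 + n)%N in A As Ap *.
pose a := A 0 0; pose b : 'rV[R]_n := ursubmx A; pose C : 'M[R]_n := drsubmx A.
have AE : A = block_mx a%:M b b^T C.
  rewrite -[LHS]submxK /b /C trmx_ursub As; congr block_mx.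
  by apply/matrixP => i j; rewrite !ord1 !mxE /=; congr (A _ _); exact/val_inj.
have Cs : C^T = C by rewrite /C trmx_drsub As.
have a0 : 0 < a.
  have : col_mx 1%:M (0 : 'cV[R]_n) != 0.
    by apply/eqP => /matrixP/(_ (lshift n 0) 0)/eqP; rewrite col_mxEu !mxE oner_eq0.
  move=> /Ap; rewrite /quad_form AE tr_col_mx trmx0 tr_scalar_mx.
  rewrite mul_row_block mul_row_col.
  by rewrite !mul0mx !mulmx0 !addr0 mul1mx mulmx1 mxE eqxx.
have an0 : a != 0 by rewrite gt_eqF.
pose C' := C - a^-1 *: (b^T *m b).
have [||V [Vt V0] VE] := IH C'.
- by rewrite /C' linearB linearZ /= trmx_mul trmxK Cs.
(* This first coordinate minimises the form of [A] for fixed [w], and the minimum is the form of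
   [C'] at [w]. *)
- move=> w w0; have : col_mx (- a^-1 *: (b *m w)) w != 0.
    by rewrite col_mx_eq0 negb_and w0 orbT.
  move=> /Ap; rewrite /quad_form AE tr_col_mx mul_row_block mul_row_col.
  set q := b *m w; have qs : q^T = q by apply/matrixP => i j; rewrite !ord1 mxE.
  have -> : (- a^-1 *: q)^T = - a^-1 *: q by rewrite linearZ /= qs.
  rewrite /C' mulmxBr mulmxBl.
  have wb : w^T *m b^T = q by rewrite -trmx_mul qs.
  have -> : - a^-1 *: q *m a%:M + w^T *m b^T = 0.
    by rewrite wb mul_mx_scalar scalerA mulrN mulfV // scaleN1r addNr.
  rewrite mul0mx add0r mulmxDl -!scalemxAl -scalemxAr -scalemxAl mulmxA wb.
  by rewrite scaleNr addrC.
pose s := Num.sqrt a; have s0 : 0 < s by rewrite sqrtr_gt0.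
have ss : s * s = a by rewrite -expr2 sqr_sqrtr // ltW.
exists (block_mx s%:M (s^-1 *: b) 0 V).
  split => [i j|i].
    case: (split_ordP i) => i' ->; case: (split_ordP j) => j' -> /=.
    - by rewrite !ord1.
    - by rewrite !ord1.
    - by rewrite block_mxEdl mxE.
    - by rewrite block_mxEdr ltn_add2l => /Vt.
  case: (split_ordP i) => i' ->.
    by rewrite block_mxEul ord1 mxE eqxx.
  by rewrite block_mxEdr.
rewrite AE tr_block_mx trmx0 tr_scalar_mx linearZ /= mulmx_block.
rewrite !mul0mx !mulmx0 !addr0 -scalar_mxM ss VE.
rewrite mul_scalar_mx mul_mx_scalar !scalerA mulfV ?gt_eqF // !scale1r.
congr block_mx; rewrite -scalemxAl -scalemxAr scalerA -invfM ss /C'.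
by rewrite addrC subrK.
Qed.

End cholesky.

(** * Lattices with a generator matrix of determinant 1 *)

Section packing_of_generator_matrix.
Variables (R : realType) (n : nat) (M : 'M[R]_n) (r k : R).
Local Notation real_mx := (map_mx (intr : int -> R)).
Hypotheses (Mt : upper_triangular M) (M1 : \det M = 1) (r0 : 0 < r).
Hypothesis vE : volume (open_ball (0 : 'cV[R]_n) r) = k%:E.
Hypothesis no_short : forall z : 'cV[int]_n,
  z != 0 -> r ^+ 2 <= sqnorm (M *m real_mx z).

Let L : set 'cV[R]_n := [set M *m real_mx z | z in [set: 'cV[int]_n]].

Let Mu : M \in unitmx. Proof. by rewrite unitmxE M1 unitr1. Qed.

Let LB (x y : 'cV[R]_n) : L x -> L y -> L (x - y).
Proof.
by move=> [z _ <-] [w _ <-]; exists (z - w) => //; rewrite map_mxB mulmxBr.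
Qed.

Let L_short (x y : 'cV[R]_n) : L x -> L y -> sqnorm (x - y) < r ^+ 2 -> x = y.
Proof.
move=> Lx Ly; have [z _ zE] := LB Lx Ly => H; apply/eqP; rewrite -subr_eq0 -zE.
have [->|/no_short] := eqVneq z 0; first by rewrite map_mx0 mulmx0.
by rewrite zE leNgt H.
Qed.

Let unit_cell : set 'cV[R]_n := box (fun=> `[0, 1[%classic).

Let F : set 'cV[R]_n := mulmx (invmx M) @^-1` unit_cell.

Let F_fundamental : fundamental_domain L F.
Proof.
split.
  by apply: borel_mulmx; apply: borel_box => i; exact: measurable_itv.
move=> x; move yE : (invmx M *m x) => y.
pose z : 'cV[int]_n := \col_i Num.floor (y i 0).
exists (M *m real_mx z); split.
  split; first by exists z.
  move=> i; rewrite mulmxBr mulKmx // yE /= in_itv /= !mxE subr_ge0 ltrBlDl.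
  by rewrite -intrD1 floor_itv.
move=> _ [[w _ <-]] xw; congr (M *m _); congr map_mx.
apply/matrixP => i j; rewrite ord1 mxE; apply: floor_def.
have := xw i; rewrite mulmxBr mulKmx // yE /= in_itv /= !mxE subr_ge0 ltrBlDl.
by rewrite intrD1.
Qed.

Let F_volume : volume F = 1%E.
Proof.
have : volume unit_cell = volume F.
  have -> : unit_cell = mulmx M @^-1` F.
    by apply/seteqP; split => x; rewrite /F /= mulKmx.
  rewrite volume_upper_triangular ?M1 ?invr1 ?mul1e //.
  by case: F_fundamental.
move=> <-; rewrite -(expr1n R n) -(volume_itv_box (0 : 'cV[R]_n)) //.
by congr (volume (box _)); apply/funext => i; rewrite mxE add0r.
Qed.

(** A single fundamental domain bounds the infimum from above, the direction that bounds the
    efficiency from below. *)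
Let covolume_le1 : (covolume L <= 1)%E.
Proof. by rewrite -F_volume; apply: ereal_inf_lbound; exists F. Qed.

Lemma lattice_packing_of_generator_matrix :
  is_lattice_packing L (r / 2) /\
  ((2 ^- n * k)%:E <= packing_efficiency L (r / 2))%E.
Proof.
have r20 : 0 < r / 2 by rewrite divr_gt0.
split; last first.
  rewrite /packing_efficiency [r / 2]mulrC volume_ball_scale // ?invr_gt0 // vE -EFinM.
  have k0 : 0 < k.
    by have [v v0] := volume_ball_fin n r0; rewrite vE => -[->].
  rewrite exprVn -[leLHS]mule1 lee_pmul2l // ?lte_fin ?mulr_gt0 ?invr_gt0 ?exprn_gt0 //.
  rewrite inve_ge1 //.
  by apply/ereal_infP => _ [D _ <-]; exact: measure_ge0.
split => //.
- split.
  + split; first by rewrite inE; exists 0 => //; rewrite map_mx0 mulmx0.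
    by move=> x y; rewrite !inE; exact: LB.
  + move=> x Lx; split; first by rewrite inE.
    (* Neighbourhoods are those of the sup norm; a sup-norm ball of this radius fits in the
       Euclidean ball of radius [r]. *)
    pose e := r / (n.+1%:R).
    have e0 : 0 < e by rewrite divr_gt0 ?ltr0n.
    exists (ball x e); first exact: nbhsx_ballx.
    apply/seteqP; split => [y [[_ xy] Ly]|_ ->]; last by split => //; exact: ballxx.
    apply/esym/L_short => //.
    apply: le_lt_trans (_ : \sum_(i < n) e ^+ 2 < _).
      apply: ler_sum => i _; rewrite !mxE -(real_normK (num_real _)).
      by rewrite ler_pXn2r ?nnegrE ?normr_ge0 ?(ltW e0) // ltW //; exact: xy.
    rewrite sumr_const card_ord exprMn -mulrnAr gtr_pMr ?exprn_gt0 //.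
    rewrite -mulr_natl exprVn ltr_pdivrMr ?exprn_gt0 ?ltr0n // mul1r -natrX ltr_nat.
    by rewrite expnS expn1 mulSn ltn_addr.
  + by rewrite (le_lt_trans covolume_le1) // ltry.
- move=> x y Lx Ly [z []]; rewrite /open_ball /= !enorm_lt // => zx zy.
  apply: L_short => //.
  (* With [t = 1], the squared distance of [x] and [y] is less than
     [2 * (2 * (r / 2) ^+ 2) = r ^+ 2]. *)
  have -> : x - y = (z - y) + (-1) *: (z - x).
    by rewrite scaleN1r opprB [RHS]addrC addrA subrK.
  apply: le_lt_trans (sqnormD_le _ _ ltr01) _.
  rewrite sqnormZ sqrrN expr1n mul1r invr1 -mulrDr.
  apply: lt_le_trans (_ : 2 * ((r / 2) ^+ 2 + (r / 2) ^+ 2) <= _).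
    by rewrite ltr_pM2l // ltrD.
  by rewrite le_eqVlt; apply/orP; left; apply/eqP; field.
Qed.

(** Take the inverse of [M] for [g]: an integer point of the image of the ball is a vector [z] with
    [M *m z] in the ball, hence zero. *)
Lemma c_const_of_generator_matrix : (k%:E <= c_const R n)%E.
Proof.
apply: ereal_sup_ubound; exists (invmx M, r) => /=.
  split => //; first by rewrite det_inv M1 invr1.
  apply/seteqP; split => [x [[b /(mem_open_ball0 _ r0) br <-] xZ]|_ ->].
    pose z : 'cV[int]_n := \col_i Num.floor ((invmx M *m b) i 0).
    have zE : real_mx z = invmx M *m b.
      by apply/matrixP => i j; rewrite ord1 !mxE floorK //; have := xZ i; rewrite mxE.
    have [z0|/no_short] := eqVneq z 0; first by rewrite /= -zE z0 map_mx0.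
    by rewrite zE mulKVmx // leNgt br.
  split; last by move=> i; rewrite mxE rpred0.
  exists 0; last by rewrite mulmx0.
  apply/mem_open_ball0 => //; rewrite /sqnorm big1 ?exprn_gt0 // => i _.
  by rewrite mxE expr0n.
rewrite -vE.
have -> : mulmx (invmx M) @` open_ball 0 r = mulmx M @^-1` open_ball 0 r.
  apply/seteqP; split => [_ [b br <-]|x xr] /=; first by rewrite mulKVmx.
  by exists (M *m x) => //; rewrite mulKmx.
rewrite volume_upper_triangular ?M1 ?invr1 ?mul1e //; exact: borel_open_ball.
Qed.

End packing_of_generator_matrix.

(** * Algebras with underlying group Z^m *)

Section integral_algebra.
Variables (m : nat) (mu : 'cV[int]_m -> 'cV[int]_m -> 'cV[int]_m).
Hypotheses (muBr : forall a, zmod_morphism (mu a))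
           (muBl : forall b, zmod_morphism (mu^~ b)).

Definition mx_of_fun (f : 'cV[int]_m -> 'cV[int]_m) : 'M[int]_m :=
  \matrix_(i, j) f (delta_mx j 0) i 0.

Lemma mx_of_funE (f : 'cV[int]_m -> 'cV[int]_m) v :
  zmod_morphism f -> f v = mx_of_fun f *m v.
Proof.
move=> fB; pose F : {additive _ -> _} := HB.pack f (GRing.isZmodMorphism.Build _ _ f fB).
apply/matrixP => i j; rewrite [j]ord1 mxE {1}(matrix_sum_delta v) -[f]/(F : _ -> _).
rewrite raddf_sum summxE; apply: eq_bigr => k _.
rewrite big_ord1 -[v k 0]intz scaler_int raddfMz mxE -scaler_int !mxE intz.
by rewrite mulrC.
Qed.

Definition lmx a := mx_of_fun (mu a).
Definition rmx b := mx_of_fun (mu^~ b).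

Lemma lmxE a b : mu a b = lmx a *m b. Proof. exact: mx_of_funE. Qed.

Lemma rmxE a b : mu a b = rmx b *m a.
Proof. exact: (mx_of_funE a (muBl b)). Qed.

Hypothesis muA : associative mu.
Hypothesis mu_eq0 : forall a b, mu a b = 0 -> a = 0 \/ b = 0.

Lemma mulmx_cV_inj (A B : 'M[int]_m) : (forall v : 'cV_m, A *m v = B *m v) -> A = B.
Proof.
move=> AB; apply/matrixP => i j.
by have /matrixP/(_ i 0) := AB (delta_mx j 0); rewrite -!colE !mxE.
Qed.

Lemma lmxM a b : lmx (mu a b) = lmx a *m lmx b.
Proof. by apply: mulmx_cV_inj => v; rewrite -mulmxA -!lmxE muA. Qed.

(** A nonzero kernel vector would be a zero divisor. *)
Lemma det_lmx_neq0 a : a != 0 -> \det (lmx a) != 0.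
Proof.
apply: contraNneq; rewrite -det_tr => /eqP/det0P[v v0 vA].
have : mu a v^T = 0 by rewrite lmxE -[lmx a]trmxK -trmx_mul vA trmx0.
by case/mu_eq0 => [-> //|/eqP]; rewrite trmx_eq0 (negbTE v0).
Qed.

(* Multiplication by [a] is injective modulo any [p] prime to its determinant:
   multiply by the adjugate. *)
Lemma lmx_inj_mod (p : nat) a b u : coprime p `|\det (lmx a)| ->
  mu a b = p%:Z *: u -> forall i, (p%:Z %| b i 0%R)%Z.
Proof.
move=> pa ab i; have : \adj (lmx a) *m mu a b = \adj (lmx a) *m (p%:Z *: u).
  by rewrite ab.
rewrite lmxE mulmxA mul_adj_mx mul_scalar_mx -scalemxAr.
move/(congr1 (fun w : 'cV_m => w i 0)); rewrite mxE [RHS]mxE => E.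
have : (p%:Z %| \det (lmx a) * b i 0%R)%Z by rewrite E dvdz_mulr.
by rewrite Gauss_dvdzr // coprimezE.
Qed.

Lemma exists_coprime_modulus (B l : nat) : exists2 p : nat, (l < p)%N &
  odd p /\ forall a : 'cV_m, a != 0 -> (forall i, `|a i 0%R| <= B)%N ->
    coprime p `|\det (lmx a)|.
Proof.
pose vec (k : {ffun 'I_m -> 'I_(B + B).+1}) : 'cV[int]_m := \col_i ((k i)%:Z - B%:Z).
pose N := (\prod_(k | vec k != 0%R) `|\det (lmx (vec k))|)%N.
have N0 : (0 < N)%N.
  by apply: prodn_cond_gt0 => k k0; rewrite absz_gt0 det_lmx_neq0.
(* Being 1 modulo [2 * N], it is odd and prime to every determinant in the product [N], which runs
   over all nonzero vectors with coordinates in [[-B, B]]. *)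
exists (l * (2 * N)).+1; first by rewrite ltnS leq_pmulr // muln_gt0.
split; first by rewrite /= mulnCA oddM.
move=> a a0 aB.
pose k : {ffun 'I_m -> 'I_(B + B).+1} := [ffun i => inord (absz (a i 0 + B%:Z))].
have ak : vec k = a.
  apply/matrixP => i j; rewrite ord1 mxE ffunE.
  by have := aB i; move: (a i 0) => x xB; rewrite inordK; lia.
have aN : (`|\det (lmx a)| %| N)%N.
  by rewrite /N (bigD1 k) ?ak //= dvdn_mulr.
apply: coprime_dvdr (coprimeSn _); apply: dvdn_trans aN _.
by rewrite mulnA dvdn_mull.
Qed.

End integral_algebra.

(** * Vectors that are not divisible by 2 *)

Section primitive_vectors.
Variables (R : realType) (n : nat).
Local Notation real_mx := (map_mx (intr : int -> R)).

Lemma even_vectorP (z : 'cV[int]_n) :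
  reflect (exists w, z = 2 *: w) (even_vector z).
Proof.
apply: (iffP forallP) => [z2|[w ->] i]; last by rewrite mxE dvdz_mulr.
exists (\col_i (z i 0%R %/ 2)%Z); apply/matrixP => i j.
by rewrite ord1 !mxE mulrC divzK.
Qed.

(** Halve as long as possible: this never lengthens the vector, and the sum of the absolute
    coordinates decreases. *)
Lemma exists_short_odd_vector (M : 'M[R]_n) (c : R) (z : 'cV[int]_n) :
  z != 0 -> sqnorm (M *m real_mx z) < c ->
  exists2 w : 'cV[int]_n, ~~ even_vector w & sqnorm (M *m real_mx w) < c.
Proof.
have [k] := ubnP (\sum_i `|z i 0%R|)%N; elim: k z => // k IH z zk z0 zc.
have [/even_vectorP[w zw]|] := boolP (even_vector z); last by exists z.
have w0 : w != 0 by apply: contraNneq z0 => w0; rewrite zw w0 scaler0.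
apply: (IH w) => //.
  have wpos : (0 < \sum_i `|w i 0%R|)%N.
    rewrite lt0n; apply: contra w0 => /eqP/eqP; rewrite sum_nat_eq0 => /forallP H.
    apply/eqP/matrixP => i j; rewrite ord1 mxE; apply/eqP; rewrite -absz_eq0.
    exact: (H i).
  move: zk; have -> : (\sum_i `|z i 0%R| = 2 * \sum_i `|w i 0%R|)%N.
    by rewrite big_distrr; apply: eq_bigr => i _; rewrite zw mxE abszM.
  by move: wpos; move: (\sum_i _)%N => N; lia.
apply: le_lt_trans zc; rewrite zw map_mxZ -scalemxAr sqnormZ.
by rewrite -[leLHS]mul1r ler_wpM2r ?sqnorm_ge0 // exprn_ege1 // ler1z.
Qed.

Lemma sqnorm_int_ge1 (z : 'cV[int]_n) : z != 0 -> 1 <= sqnorm (real_mx z).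
Proof.
move=> z0; have [i zi] : exists i, z i 0 != 0.
  apply/existsP; apply: contraNT z0; rewrite negb_exists => /forallP H.
  by apply/eqP/matrixP => i j; rewrite ord1 mxE; apply/eqP; rewrite -[_ == _]negbK H.
apply: le_trans (sqr_coord_le _ i); rewrite mxE -rmorphXn /= -[1]/(1%:~R) ler_int.
by move: zi; nia.
Qed.

End primitive_vectors.

(** * The averaging argument *)

Section averaging.
Variable R : realType.

Lemma dvdz2_addl (a b : int) : (2 %| a + 2 * b)%Z = (2 %| a)%Z.
Proof. by lia. Qed.

Lemma sqnorm_col_mx n1 n2 (x : 'cV[R]_n1) (y : 'cV[R]_n2) :
  sqnorm (col_mx x y) = sqnorm x + sqnorm y.
Proof.
rewrite /sqnorm big_split_ord /=; congr (_ + _); apply: eq_bigr => i _;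
  by rewrite (col_mxEu, col_mxEd).
Qed.

(** By induction on [n], giving one factor [Num.sqrt c] to [1 + t] and the other to its [n]-th
    power. *)
Lemma exists_expn_lt n (c : R) : 1 < c -> exists2 t : R, 0 < t & (1 + t) ^+ n < c.
Proof.
elim: n c => [|n IH] c c1; first by exists 1.
have c0 : 0 < c := lt_trans ltr01 c1.
have s0 : 0 < Num.sqrt c by rewrite sqrtr_gt0.
have s1 : 1 < Num.sqrt c by rewrite -sqrtr1 ltr_sqrt.
have [t t0 tn] := IH _ s1.
exists (Num.min t (Num.sqrt c - 1)); first by rewrite lt_min t0 subr_gt0.
set u := Num.min _ _.
have u0 : 0 < u by rewrite lt_min t0 subr_gt0.
have ut : u <= t by rewrite ge_min lexx.
have us : u <= Num.sqrt c - 1 by rewrite ge_min lexx orbT.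
rewrite exprS -[ltRHS](sqr_sqrtr (ltW c0)) expr2.
have un : (1 + u) ^+ n < Num.sqrt c.
  apply: le_lt_trans tn; rewrite lerXn2r ?nnegrE ?addr_ge0 ?(ltW u0) ?(ltW t0) //.
  by rewrite lerD2l.
apply: le_lt_trans (_ : Num.sqrt c * (1 + u) ^+ n < _).
  rewrite ler_wpM2r ?exprn_ge0 ?addr_ge0 ?(ltW u0) //; lra.
by rewrite ltr_pM2l.
Qed.

Lemma exists_sqnorm_bound n (U : 'M[R]_n) : exists2 K : R, 1 <= K &
  forall u : 'cV[R]_n, (forall i, 0 <= u i 0 < 2) -> sqnorm (U *m u) <= K.
Proof.
pose S := \sum_i (\sum_j `|U i j| * 2) ^+ 2.
have S0 : 0 <= S by apply: sumr_ge0 => i _; exact: sqr_ge0.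
(* The summand 1 ensures [1 <= K], by which [(2 * K) ^+ 2] later dominates [2 * K]. *)
exists (1 + S) => [|u u2]; first by rewrite lerDl.
apply: le_trans (_ : S <= _); last by rewrite lerDr.
apply: ler_sum => i _; rewrite -(real_normK (num_real _)).
have a0 : 0 <= \sum_j `|U i j| * 2 by apply: sumr_ge0 => j _; rewrite mulr_ge0.
rewrite ler_pXn2r ?nnegrE // mxE; apply: le_trans (ler_norm_sum _ _ _) _.
apply: ler_sum => j _; rewrite normrM ler_wpM2l //.
by have /andP[uj0 uj2] := u2 j; rewrite ger0_norm // ltW.
Qed.

Lemma upper_triangular_block n1 n2 (A : 'M[R]_n1) B (C : 'M[R]_n2) :
  upper_triangular A -> upper_triangular C -> upper_triangular (block_mx A B 0 C).
Proof.
move=> [At A0] [Ct C0]; split => [i j|i].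
  case: (split_ordP i) => i' ->; case: (split_ordP j) => j' -> /=.
  - by rewrite block_mxEul => /At.
  - by move=> ij; exfalso; have := ltn_ord i'; lia.
  - by rewrite block_mxEdl mxE.
  - by rewrite block_mxEdr ltn_add2l => /Ct.
by case: (split_ordP i) => i' ->; rewrite (block_mxEul, block_mxEdr).
Qed.

Lemma upper_triangularZ n (a : R) (A : 'M[R]_n) :
  0 < a -> upper_triangular A -> upper_triangular (a *: A).
Proof.
move=> a0 [At A0]; split => [i j ij|i]; rewrite mxE; first by rewrite At ?mulr0.
by rewrite mulr_gt0.
Qed.

Local Notation real_mx := (map_mx (intr : int -> R)).

Lemma real_mxZ n (k : nat) (v : 'cV[int]_n) :
  real_mx (k%:Z *: v) = k%:R *: real_mx v.
Proof. by apply/matrixP => i j; rewrite !mxE intrM. Qed.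

Variables (m : nat) (mu : 'cV[int]_m -> 'cV[int]_m -> 'cV[int]_m).
Hypotheses (muBr : forall a, zmod_morphism (mu a))
           (muBl : forall b, zmod_morphism (mu^~ b)).
Hypothesis muA : associative mu.
Hypothesis mu_eq0 : forall a b, mu a b = 0 -> a = 0 \/ b = 0.
Variables (G : {fset 'cV[int]_m}) (e : 'cV[int]_m).
Hypotheses (m0 : (0 < m)%N) (eG : e \in G) (mue : left_id e mu).
Hypothesis GM : forall g h, g \in G -> h \in G -> mu g h \in G.
Hypothesis GV : forall g, g \in G -> exists2 h, h \in G & mu h g = e.

Let mu0r a : mu a 0 = 0. Proof. by have := muBr a 0 0; rewrite /= !subrr. Qed.
Let mu0l b : mu 0 b = 0.
Proof. by have := muBl b 0 0; rewrite /= !subrr. Qed.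

Let lam a : 'M[R]_m := real_mx (lmx mu a).
Let rho b : 'M[R]_m := real_mx (rmx mu b).

Let lamE a b : real_mx (mu a b) = lam a *m real_mx b.
Proof. by rewrite (lmxE muBr) map_mxM. Qed.

Let rhoE a b : real_mx (mu a b) = rho b *m real_mx a.
Proof. by rewrite (rmxE muBl) map_mxM. Qed.

Let mu_neq0 g y : g \in G -> y != 0 -> mu g y != 0.
Proof.
move=> gG; have [h hG hg] := GV gG; apply: contra_neq => gy0.
by rewrite -(mue y) -hg -muA gy0 mu0r.
Qed.

Let mu_inj g g' y : y != 0 -> mu g y = mu g' y -> g = g'.
Proof.
move=> y0 E; have : mu (g - g') y = 0 by rewrite (muBl y) E subrr.
by case/mu_eq0 => /eqP; rewrite ?(negbTE y0) // subr_eq0 => /eqP.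
Qed.

Let nonzero : 'cV[int]_m := const_mx 1.

Let nonzero_neq0 : nonzero != 0.
Proof. by apply/eqP => /matrixP/(_ (Ordinal m0) 0)/eqP; rewrite !mxE oner_eq0. Qed.

Let G_neq0 g : g \in G -> g != 0.
Proof.
by move=> gG; apply: contraTneq (mu_neq0 gG nonzero_neq0) => ->; rewrite mu0l eqxx.
Qed.

(** The standard form summed over the group, to make it invariant; the term of [e] keeps it above
    [sqnorm]. *)
Let q (v : 'cV[R]_m) : R := \sum_(g <- G) sqnorm (lam g *m v).

Let lam_e : lam e = 1%:M.
Proof.
rewrite /lam (_ : lmx mu e = 1%:M) ?map_mx1 //.
by apply: mulmx_cV_inj => v; rewrite -(lmxE muBr) mue mul1mx.
Qed.

Let q_ge v : sqnorm v <= q v.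
Proof.
rewrite /q (big_fsetD1 e) //= lam_e mul1mx lerDl.
by apply: sumr_ge0 => g _; exact: sqnorm_ge0.
Qed.

Let qZ a v : q (a *: v) = a ^+ 2 * q v.
Proof.
by rewrite /q mulr_sumr; apply: eq_bigr => g _; rewrite -scalemxAr sqnormZ.
Qed.

Let lamM a b : lam (mu a b) = lam a *m lam b.
Proof. by rewrite /lam (lmxM muBr muA) map_mxM. Qed.

(** Right multiplication by [h] is injective on the finite set [G] and maps it into itself, so it
    permutes the terms. *)
Let q_inv h v : h \in G -> q (lam h *m v) = q v.
Proof.
move=> hG; have inj_h : {in G &, injective (mu^~ h)}.
  by move=> g g' _ _ /=; apply: mu_inj; exact: G_neq0.
have GE : [fset mu g h | g in G]%fset = G.
  apply/eqP; rewrite eqEfcard card_in_imfset //= leqnn andbT.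
  by apply/fsubsetP => _ /imfsetP[g gG ->]; exact: GM.
rewrite [in RHS]/q -[in RHS]GE big_imfset //= /q.
by apply: eq_bigr => g _; rewrite lamM mulmxA.
Qed.

Let exists_cholesky_factor :
  exists2 U : 'M[R]_m, upper_triangular U & forall v, sqnorm (U *m v) = q v.
Proof.
pose A := \sum_(g <- G) (lam g)^T *m lam g.
have AE v : quad_form A v = q v.
  rewrite /quad_form /A mulmx_sumr mulmx_suml summxE; apply: eq_bigr => g _.
  by rewrite sqnormE trmx_mul !mulmxA.
have [||U Ut UE] := @cholesky _ _ A.
- rewrite /A raddf_sum; apply: eq_bigr => g _.
  by rewrite /= trmx_mul trmxK.
- move=> v v0; rewrite AE (lt_le_trans _ (q_ge v)) // lt_neqAle sqnorm_ge0 andbT.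
  by apply: contra_neqN v0 => /eqP/esym/sqnorm_eq0.
exists U => // v; rewrite -AE /quad_form -UE sqnormE trmx_mul.
by rewrite !mulmxA.
Qed.

Variable r : R.
Hypothesis r0 : 0 < r.
Hypothesis vE :
  volume (open_ball (0 : 'cV[R]_(m + m)) r) = (#|` G|%fset%:R)%:E.

Let card_G_gt0 : (0 < #|` G|%fset)%N.
Proof. by rewrite cardfs_gt0; apply/fset0Pn; exists e. Qed.

(* [eps * delta] is normalised by the determinant of [U]; [delta] is small with
   respect to the cells of [M0]; [p] is large with respect to [eps / delta] and
   prime to the determinants of the finitely many relevant [y].  If every
   lattice [Ms s] had a short vector [(x s, y s)], the vectors [g (x s, y s)],
   read in the coordinates [p x + y s, y] of the common overlattice [M0], would
   be [p ^ m * #|G|] distinct short points of [M0], none of them even. *)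
Lemma exists_generator_without_short_vector :
  exists M : 'M[R]_(m + m), [/\ upper_triangular M, \det M = 1 &
    forall z : 'cV[int]_(m + m), z != 0 -> r ^+ 2 <= sqnorm (M *m real_mx z)].
Proof.
have [U Ut UE] := exists_cholesky_factor.
have d0 := det_upper_triangular_gt0 Ut; set d := \det U in d0.
have [K K1 KU] := exists_sqnorm_bound U.
have N1 : (1 : R) < 2 ^+ (m + m) by rewrite exprn_egt1 ?ltr1n // -lt0n addn_gt0 m0.
have N10 : (0 : R) < 2 ^+ (m + m) - 1 by rewrite subr_gt0.
(* The enlargement [(1 + t) ^+ (m + m)] must stay below the gain from leaving out the even class. *)
have [t t0 tn] : exists2 t : R, 0 < t &
    (1 + t) ^+ (m + m) < 2 ^+ (m + m) / (2 ^+ (m + m) - 1).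
  by apply: exists_expn_lt; rewrite ltr_pdivlMr // mul1r ltrBlDr ltrDl.
have [c c0 cm] : exists2 c : R, 0 < c & c ^+ m * (d * d) = 1.
  exists ((d * d)^-1 `^ m%:R^-1); first by rewrite powR_gt0 // invr_gt0 mulr_gt0.
  rewrite -powR_mulrn ?powR_ge0 // -powRrM mulVf ?pnatr_eq0 -?lt0n //.
  by rewrite powRr1 ?mulVf ?invr_ge0 ?mulf_neq0 ?gt_eqF // mulr_ge0 // ltW.
have K0 : 0 < K := lt_le_trans ltr01 K1.
(* The first bound gives [r <= eps], which excludes short vectors with [y = 0]; the second makes the
   cells of [M0] small. *)
pose delta := Num.min (c / r) (t * r / (2 * K)).
have delta0 : 0 < delta.
  by rewrite lt_min !divr_gt0 ?mulr_gt0.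
pose eps := c / delta.
have eps0 : 0 < eps by rewrite divr_gt0.
have eps_r : r <= eps.
  by rewrite ler_pdivlMr // mulrC -ler_pdivlMr // ge_min lexx.
have delta_small : 2 * K * delta ^+ 2 <= (t * r) ^+ 2.
  have : delta <= t * r / (2 * K) by rewrite ge_min lexx orbT.
  rewrite ler_pdivlMr ?mulr_gt0 // => H.
  apply: le_trans (_ : (delta * (2 * K)) ^+ 2 <= _); last first.
    by rewrite ler_pXn2r ?nnegrE ?mulr_ge0 // ltW.
  rewrite -subr_ge0 (_ : _ - _ = (2 * K * delta ^+ 2) * (2 * K - 1)); last by ring.
  by rewrite mulr_ge0 ?mulr_ge0 ?sqr_ge0 ?(ltW K0) //; lra.
have epsdelta : (eps * delta) ^+ m * (d * d) = 1 by rewrite divfK ?gt_eqF.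
(* Bounds the coordinates of any [y] that occurs in a short vector. *)
pose B := Num.Def.truncn (r / delta).
have [p pl [podd pcop]] :=
  exists_coprime_modulus muBr mu_eq0 B (Num.Def.truncn (eps / delta)).
have p0 : (0 < p)%N by rewrite (leq_ltn_trans _ pl).
have pR0 : (0 : R) < p%:R by rewrite ltr0n.
have eps_p : eps / p%:R <= delta.
  rewrite ler_pdivrMr // mulrC -ler_pdivrMr // ltW //.
  by apply: lt_le_trans (truncnS_gt _) _; rewrite ler_nat.
have epsp0 : 0 < eps / p%:R by rewrite divr_gt0.
(* Generator matrix of [L_s]; the factor [U] turns the standard norm into [q]. *)
pose Ms s := block_mx (eps *: U) ((eps / p%:R) *: (U *m rho s)) 0 (delta *: U).
pose M0 : 'M[R]_(m + m) := block_mx ((eps / p%:R) *: U) 0 0 (delta *: U).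
have MsE s x y : sqnorm (Ms s *m real_mx (col_mx x y)) =
    (eps / p%:R) ^+ 2 * q (real_mx (p%:Z *: x + mu y s)) +
    delta ^+ 2 * q (real_mx y).
  rewrite map_col_mx mul_block_col mul0mx add0r sqnorm_col_mx -!qZ -!UE.
  congr (_ + _); apply: congr1; last by rewrite -scalemxAl scalemxAr.
  rewrite map_mxD real_mxZ rhoE scalerDr mulmxDr scalerA divfK ?gt_eqF //.
  by rewrite -!scalemxAl -!scalemxAr mulmxA.
have M0E x y : sqnorm (M0 *m real_mx (col_mx x y)) =
    (eps / p%:R) ^+ 2 * q (real_mx x) + delta ^+ 2 * q (real_mx y).
  rewrite map_col_mx mul_block_col !mul0mx add0r addr0 sqnorm_col_mx -!qZ -!UE.
  by rewrite -!scalemxAl !scalemxAr.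
have Mst s : upper_triangular (Ms s).
  by apply: upper_triangular_block; exact: upper_triangularZ.
have Ms1 s : \det (Ms s) = 1.
  rewrite det_ublock !detZ -/d mulrACA -exprMn; exact: epsdelta.
have M0t : upper_triangular M0.
  by apply: upper_triangular_block; exact: upper_triangularZ.
have M01 : \det M0 = p%:R ^- m.
  rewrite det_ublock !detZ -/d mulrACA -exprMn mulrAC exprMn mulrAC epsdelta mul1r.
  by rewrite exprVn.
pose vec (s : {ffun 'I_m -> 'I_p}) : 'cV[int]_m := \col_i (s i)%:Z.
have [[s Hs]|bad] := pselect (exists s, forall z : 'cV[int]_(m + m),
    z != 0 -> r ^+ 2 <= sqnorm (Ms (vec s) *m real_mx z)).
  by exists (Ms (vec s)).
exfalso.
have {bad} /choice[xy xyP] : forall s, exists w : 'cV[int]_(m + m),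
    ~~ even_vector w /\ sqnorm (Ms (vec s) *m real_mx w) < r ^+ 2.
  move=> s; apply: contrapT => Hs; apply: bad; exists s => z z0.
  rewrite leNgt; apply/negP => zr.
  by have [w w2 wr] := exists_short_odd_vector z0 zr; apply: Hs; exists w.
pose x s := usubmx (xy s); pose y s := dsubmx (xy s).
have xyE s : xy s = col_mx (x s) (y s) by rewrite vsubmxK.
have short s : (eps / p%:R) ^+ 2 * q (real_mx (p%:Z *: x s + mu (y s) (vec s))) +
    delta ^+ 2 * q (real_mx (y s)) < r ^+ 2.
  by rewrite -MsE -xyE; case: (xyP s).
(* Otherwise [x s] is nonzero, since [xy s] is not even, and the vector has length at least
   [eps]. *)
have y0 s : y s != 0.
  apply/eqP => ys0; have x0 : x s != 0.
    have [+ _] := xyP s; apply: contraNneq => xs0.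
    by rewrite xyE xs0 ys0 col_mx0; apply/forallP => i; rewrite mxE dvdz0.
  have := short s; rewrite ys0 mu0l addr0 real_mxZ qZ mulrA -exprMn.
  rewrite divfK ?gt_eqF // ltNge => /negP; apply.
  apply: ler_wpDr.
    by rewrite mulr_ge0 ?sqr_ge0 // (le_trans _ (q_ge _)) ?sqnorm_ge0.
  apply: le_trans (_ : eps ^+ 2 * 1 <= _).
    by rewrite mulr1 ler_pXn2r ?nnegrE // ltW.
  rewrite ler_wpM2l ?sqr_ge0 //; apply: le_trans (q_ge _).
  exact: sqnorm_int_ge1.
pose f (j : {ffun 'I_m -> 'I_p} * G) : 'cV[int]_(m + m) :=
  col_mx (p%:Z *: mu (fsval j.2) (x j.1) + mu (mu (fsval j.2) (y j.1)) (vec j.1))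
         (mu (fsval j.2) (y j.1)).
have muZ a (k : int) b : mu a (k *: b) = k *: mu a b.
  by rewrite !(lmxE muBr) -scalemxAr.
have muD a b b' : mu a (b + b') = mu a b + mu a b'.
  by rewrite !(lmxE muBr) mulmxDr.
have f_short j : sqnorm (M0 *m real_mx (f j)) < r ^+ 2.
  case: j => s g; rewrite M0E /= -muA -muZ -muD !lamE !q_inv ?fsvalP //.
have f_inj : injective f.
  move=> [s g] [s' g'] /eq_col_mx [] /= E1 E2.
  (* Equal images make [Y] times [vec s - vec s'] divisible by [p]. As [Y] is nonzero with
     coordinates bounded by [B], it can be cancelled modulo [p], and the entries of [s] and [s'] are
     residues below [p]. *)
  have sE : s = s'.
    pose Y := mu (fsval g) (y s).
    have E : mu Y (vec s - vec s') = p%:Z *: (mu (fsval g') (x s') - mu (fsval g) (x s)).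
      rewrite muBr scalerBr; move: E1; rewrite -E2 -/Y.
      move: (_ *: mu _ (x s)) (_ *: mu _ (x s')) => A A' AE.
      by rewrite -[mu Y (vec s)](addrK A) [_ + A]addrC AE addrAC addrK.
    have Ycop : coprime p `|\det (lmx mu Y)|.
      apply: pcop; first by apply: mu_neq0; rewrite ?fsvalP.
      move=> i; have : delta ^+ 2 * sqnorm (real_mx Y) < r ^+ 2.
        apply: le_lt_trans (f_short (s, g)); rewrite M0E.
        apply: ler_wpDl; last by rewrite ler_wpM2l ?sqr_ge0.
        by rewrite mulr_ge0 ?sqr_ge0 // (le_trans _ (q_ge _)) ?sqnorm_ge0.
      rewrite -sqnormZ => Yr; have := le_lt_trans (sqr_coord_le _ i) Yr.
      rewrite -(real_normK (num_real _)) ltr_pXn2r ?nnegrE ?normr_ge0 ?(ltW r0) //.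
      rewrite !mxE normrM (gtr0_norm delta0) mulrC -ltr_pdivlMr // => Yi.
      rewrite -ltnS -(ltr_nat R); apply: lt_trans (truncnS_gt _).
      by rewrite natr_absz intr_norm.
    have D := lmx_inj_mod muBr Ycop E.
    apply/ffunP => i; apply/val_inj; have := D i; rewrite !mxE.
    have := ltn_ord (s i); have := ltn_ord (s' i).
    by move=> bp ap; rewrite -eqz_mod_dvd !modz_nat !modn_small // => /eqP[].
  rewrite -sE in E2 *; congr (_, _); apply/val_inj.
  exact: (mu_inj (y0 s)).
have even_mu g u : even_vector u -> even_vector (mu g u).
  by move=> /even_vectorP[u' ->]; apply/even_vectorP; exists (mu g u'); rewrite muZ.
(* If [f j] is even, so is [g y], hence [g y s], hence [p g x], hence [g x] because [p] is odd; the
   inverse of [g] then makes [xy s] even. *)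
have f_odd j : ~~ even_vector (f j).
  case: j => s g; have [+ _] := xyP s; apply: contra => /forallP fe.
  have [h hG hg] := GV (fsvalP g).
  have ye : even_vector (mu (fsval g) (y s)).
    by apply/forallP => i; have := fe (rshift m i); rewrite col_mxEd.
  have gxe : even_vector (mu (fsval g) (x s)).
    have /even_vectorP[u yu] := ye.
    apply/forallP => i; have := fe (lshift m i).
    rewrite col_mxEu /= yu mxE (_ : mu (2 *: u) _ = 2 *: mu u (vec s)); last first.
      by rewrite !(rmxE muBl) -scalemxAr.
    rewrite !mxE dvdz2_addl Gauss_dvdzr // coprimezE.
    by rewrite coprime2n.
  have gK v : mu h (mu (fsval g) v) = v by rewrite muA hg mue.
  have xe : even_vector (x s) by rewrite -(gK (x s)); exact: even_mu.
  have {}ye : even_vector (y s) by rewrite -(gK (y s)); exact: even_mu.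
  rewrite xyE; apply/forallP => i; case: (split_ordP i) => k ->.
    by rewrite col_mxEu; exact: (forallP xe).
  by rewrite col_mxEd; exact: (forallP ye).
have cell_small (u : 'cV[R]_(m + m)) : (forall i, 0 <= u i 0 < 2) ->
    sqnorm (M0 *m u) <= (t * r) ^+ 2.
  move=> u2; rewrite -[u]vsubmxK mul_block_col !mul0mx add0r addr0 sqnorm_col_mx.
  have K1' : sqnorm (U *m usubmx u) <= K by apply: KU => i; rewrite mxE; exact: u2.
  have K2' : sqnorm (U *m dsubmx u) <= K by apply: KU => i; rewrite mxE; exact: u2.
  apply: le_trans delta_small; rewrite -!scalemxAl !sqnormZ.
  rewrite (_ : 2 * K * delta ^+ 2 = delta ^+ 2 * K + delta ^+ 2 * K); last by ring.
  apply: lerD; apply: ler_pM; rewrite ?sqr_ge0 ?sqnorm_ge0 //.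
  by rewrite ler_pXn2r ?nnegrE // ltW.
(* The [p ^ m] choices of [s] cancel the determinant [p ^- m] of [M0], and the remaining inequality
   contradicts the choice of [t]. *)
have := nonzero_classes_count M0t r0 t0 cell_small f_inj f_short vE f_odd.
rewrite card_prod card_ffun !card_ord -cardfE M01 natrM natrX.
set k : R := #|` G|%fset%:R; have k0 : 0 < k by rewrite ltr0n.
have P0 : p%:R ^+ m != 0 :> R by rewrite expf_neq0 ?gt_eqF.
rewrite [leLHS](_ : _ = k * 2 ^+ (m + m)); last first.
  by move: (p%:R ^+ m) (2 ^+ (m + m)) P0 => P T P0; field.
apply/negP; rewrite -ltNge mulrA mulrC ltr_pM2l // mulrC -ltr_pdivlMr //.
Qed.

End averaging.

(** * Integral bases *)

Section lattice_basis.
Variables (V : vectType rat) (S : {pred V}).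
Local Notation m := (\dim {:V}).
Hypotheses (Sfg : finitely_generated S) (Sfull : rationally_full S).

Lemma exists_common_denominator k l (C : 'M[rat]_(k, l)) :
  exists2 N : int, N != 0 & exists A : 'M[int]_(k, l), N%:~R *: C = map_mx intr A.
Proof.
pose N := \prod_(ij : 'I_k * 'I_l) denq (C ij.1 ij.2).
exists N; first by apply/prodf_neq0 => ij _; exact: denq_neq0.
exists (\matrix_(i, j)
  (numq (C i j) * \prod_(ij | ij != (i, j)) denq (C ij.1 ij.2))).
apply/matrixP => i j; rewrite !mxE /N (bigD1 (i, j)) //= !intrM numqE.
by rewrite mulrC mulrA.
Qed.

(** Over a common denominator [N] the generators have an integer coordinate matrix [A], so [S] is
    the row span of [A] divided by [N]. Smith normal form diagonalises [A], and fullness makes all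
    [m] diagonal entries nonzero: the rows of [Rm] scaled by them form a basis. *)
Lemma exists_integral_basis : exists phi : 'cV[int]_m -> V,
  [/\ zmod_morphism phi, injective phi & forall x, x \in S <-> exists v, phi v = x].
Proof.
have [k [s sS]] := Sfg.
pose e := vbasis {:V}.
have eb : basis_of {:V} e := vbasisP _.
have coord_eP x : x = \sum_i coord e i x *: e`_i.
  by apply: (coord_basis eb); exact: memvf.
pose C := \matrix_(i < k, j < m) coord e j s`_i.
have [N N0 [A AE]] := exists_common_denominator C.
have NQ0 : N%:~R != 0 :> rat by rewrite intr_eq0.
pose vec (w : 'rV[int]_m) : V := N%:~R^-1 *: \sum_l (w 0 l)%:~R *: e`_l.
have vecB : zmod_morphism vec.
  move=> w w'; rewrite /vec -scalerBr -sumrB; congr (_ *: _).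
  by apply: eq_bigr => l _; rewrite !mxE intrB scalerBl.
have vec_inj : injective vec.
  move=> w w' /(scalerI (invr_neq0 NQ0)) E; apply/matrixP => i l; rewrite ord1.
  have := congr1 (coord e l) E.
  by rewrite !coord_sum_free ?(basis_free eb) // => /intr_inj.
have sE (i : 'I_k) : N%:~R *: s`_i = \sum_l (A i l)%:~R *: e`_l.
  rewrite [s`_i]coord_eP scaler_sumr; apply: eq_bigr => l _.
  by have /matrixP/(_ i l) := AE; rewrite !mxE scalerA => ->.
have vecE (a : 'rV[int]_k) : vec (a *m A) = \sum_(i < k) s`_i *~ a 0 i.
  rewrite /vec; apply: (scalerI NQ0); rewrite scalerA divff // scale1r scaler_sumr.
  under [RHS]eq_bigr => i _ do rewrite -scaler_int scalerA mulrC -scalerA sE scaler_sumr.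
  rewrite exchange_big /=; apply: eq_bigr => l _.
  rewrite mxE rmorph_sum scaler_suml; apply: eq_bigr => i _.
  by rewrite scalerA -intrM.
have SE x : x \in S <-> exists a : 'rV[int]_k, vec (a *m A) = x.
  rewrite sS; split => [[a ->]|[a <-]].
    by exists (\row_i a i); rewrite vecE; apply: eq_bigr => i _; rewrite mxE.
  by exists [ffun i => a 0 i]; rewrite vecE; apply: eq_bigr => i _; rewrite ffunE.
have [Lm Lu [Rm Ru [d _ AdE]]] := int_Smith_normal_form A.
pose Delta : 'M[int]_(k, m) := \matrix_(i, j) (d`_i *+ (i == j :> nat)).
(* A zero column of the Smith form would give a nonzero linear form vanishing
   on [S]. *)
have full (j : 'I_m) : (j < k)%N && (d`_j != 0).
  apply: contraT => H.
  have D0 : Delta *m delta_mx j 0 = 0 :> 'cV_k.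
    rewrite -colE; apply/matrixP => i i'; rewrite !mxE.
    have [ij|_] := eqVneq (i : nat) j; last by rewrite mulr0n.
    by move: H; rewrite -ij ltn_ord /= negbK => /eqP ->.
  pose c : 'cV[int]_m := invmx Rm *m delta_mx j 0.
  have Ac : A *m c = 0 by rewrite AdE -/Delta /c -mulmxA mulKVmx // -mulmxA D0 mulmx0.
  pose ell (x : V) : rat := \sum_l coord e l x * (c l 0)%:~R.
  have ellB : scalar ell.
    move=> a x y; rewrite /ell mulr_sumr -big_split /=.
    by apply: eq_bigr => l _; rewrite linearP mulrDl mulrA.
  have ell_s (i : 'I_k) : ell s`_i = 0.
    apply: (mulfI NQ0); rewrite mulr0 /ell mulr_sumr.
    transitivity (((A *m c) i 0)%:~R : rat); last by rewrite Ac mxE.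
    rewrite mxE rmorph_sum; apply: eq_bigr => l _; rewrite mulrA rmorphM.
    by have /matrixP/(_ i l) := AE; rewrite !mxE => ->.
  pose ellA : {scalar V} := HB.pack ell (GRing.isLinear.Build _ _ _ _ ell ellB).
  have ell_S x : x \in S -> ellA x = 0.
    move=> /sS[a ->]; rewrite raddf_sum big1 // => i _.
    transitivity (ell s`_i *~ a i); first exact: raddfMz.
    by rewrite ell_s mul0rz.
  have ell0 x : ellA x = 0.
    have [p [a [y [yS ->]]]] := Sfull x.
    rewrite raddf_sum big1 // => i _; transitivity (a i * ellA (y i)).
      exact: linearZ.
    by rewrite ell_S ?mulr0.
  have c0 : c = 0.
    apply/matrixP => l i'; rewrite ord1 [RHS]mxE; apply/eqP; rewrite -(intr_eq0 rat).
    rewrite -(ell0 e`_l) /= /ell (bigD1 l) //= big1 => [|l' l'l].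
      by rewrite coord_free ?(basis_free eb) // eqxx mul1r addr0.
    by rewrite coord_free ?(basis_free eb) // eq_sym (negbTE l'l) mul0r.
  have : Rm *m c = delta_mx j 0 by rewrite /c mulKVmx.
  rewrite c0 mulmx0 => /matrixP/(_ j 0); rewrite !mxE !eqxx => /eqP.
  by rewrite eq_sym oner_eq0.
pose Dm : 'M[int]_m := \matrix_(i, j) (d`_i *+ (i == j)).
pose phi (v : 'cV[int]_m) := vec (v^T *m Dm *m Rm).
have vDE (v : 'cV[int]_m) j : (v^T *m Dm) 0 j = v j 0 * d`_j.
  rewrite mxE (bigD1 j) //= big1 ?addr0 => [|i ij]; first by rewrite !mxE eqxx.
  by rewrite !mxE (negbTE ij) mulr0n mulr0.
pose w (j : 'I_m) : 'I_k := Ordinal (proj1 (andP (full j))).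
have bDE (b : 'rV[int]_k) j : (b *m Delta) 0 j = b 0 (w j) * d`_j.
  rewrite mxE (bigD1 (w j)) //= big1 ?addr0 => [|i ij]; first by rewrite !mxE eqxx.
  by rewrite !mxE (_ : _ == _ = false) ?mulr0n ?mulr0 //; exact: negbTE ij.
exists phi; split.
- by move=> u v; rewrite /phi linearB /= !mulmxBl vecB.
- move=> u v /vec_inj/(congr1 (mulmx^~ (invmx Rm))); rewrite !mulmxK // => E.
  apply/matrixP => j i; rewrite ord1; have := congr1 (fun u : 'rV_m => u 0 j) E.
  by rewrite /= !vDE; have /andP[_ dj] := full j; move/(mulIf dj).
- move=> x; rewrite SE; split => [[a <-]|[v <-]].
    exists (\col_j (a *m Lm) 0 (w j)).
    rewrite /phi AdE -/Delta !mulmxA; congr (vec (_ *m _)).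
    by apply/matrixP => i j; rewrite ord1 vDE bDE mxE.
  (* Pad [v] to length [k]: the default 0 fills the indices from [m] on. *)
  exists ((\row_i oapp (v^~ 0) 0 (insub (i : nat))) *m invmx Lm).
  rewrite /phi AdE -/Delta !mulmxA mulmxKV //; congr (vec (_ *m _)).
  by apply/matrixP => i j; rewrite ord1 vDE bDE mxE /= valK.
Qed.

End lattice_basis.

(** * Transport of the order and the group to Z^m *)

Theorem theorem2p2 (R : realType) (D : falgType rat) (O : {pred D})
    (G0 : {fset D}) :
  is_division_algebra D ->
  is_order O ->
  finite_unit_subgroup G0 ->
  {subset G0 <= O} ->
  let d := (2 * \dim {:D}%VS)%N in
  (exists (L : set 'cV[R]_d) (r : R),
     is_lattice_packing L r /\
     ((2 ^- d * #|` G0|%fset%:R)%:E <= packing_efficiency L r)%E) /\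
  ((#|` G0|%fset%:R)%:E <= c_const R d)%E.
Proof.
move=> Ddiv [[_ OB OM] Ofg Ofull] [Gclosed Gunit] GO.
have [G1 Gdiv] := Gclosed.
have [phi [phiB phi_inj phiO]] := exists_integral_basis Ofg Ofull.
set m := \dim {:D} in phi phiB phi_inj phiO *.
(* A total function inverting [phi] on [O]; the value 0 outside [O] is arbitrary. *)
have /choice[psi psiK] : forall x, exists v, x \in O -> phi v = x.
  move=> x; have [/phiO[v <-]|xO] := boolP (x \in O); first by exists v.
  by exists 0.
have phi_O v : phi v \in O by apply/phiO; exists v.
have phiK : cancel phi psi by move=> v; apply: phi_inj; rewrite psiK ?phi_O.

have phi0 : phi 0 = 0 by have := phiB 0 0; rewrite !subrr.
pose mu a b := psi (phi a * phi b).
have phiM a b : phi (mu a b) = phi a * phi b by rewrite psiK // OM ?phi_O.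
have muBr a : zmod_morphism (mu a).
  by move=> b c; apply: phi_inj; rewrite phiB !phiM phiB mulrBr.
have muBl b : zmod_morphism (mu^~ b).
  by move=> a c; apply: phi_inj; rewrite phiB !phiM phiB mulrBl.
have muA : associative mu.
  by move=> a b c; apply: phi_inj; rewrite !phiM mulrA.
(* Here the division property of [D] enters. *)
have mu_eq0 a b : mu a b = 0 -> a = 0 \/ b = 0.
  move=> /(congr1 phi); rewrite phiM phi0 => ab0.
  have [a0|/Ddiv au] := eqVneq (phi a) 0; [left|right]; apply: phi_inj.
    by rewrite phi0.
  by apply: (mulrI au); rewrite ab0 phi0 mulr0.
pose e := psi 1.
have phie : phi e = 1 by rewrite psiK ?GO.
pose G := [fset psi g | g in G0]%fset.
have phiG v : v \in G -> phi v \in G0.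
  by move=> /imfsetP[g gG ->]; rewrite psiK // GO.
have GphiG v : phi v \in G0 -> v \in G.
  by move=> vG; apply/imfsetP; exists (phi v); rewrite ?phiK.
have cardG : #|` G|%fset = #|` G0|%fset.
  rewrite card_in_imfset // => g h gG hG /(congr1 phi).
  by rewrite !psiK // GO.
have eG : e \in G by apply: GphiG; rewrite phie.
have mue : left_id e mu.
  by move=> v; apply: phi_inj; rewrite phiM phie mul1r.
have GV0 g : g \in G0 -> g^-1 \in G0 by move=> gG; rewrite -[g^-1]div1r Gdiv.
have GM g h : g \in G -> h \in G -> mu g h \in G.
  move=> /phiG gG /phiG hG; apply: GphiG.
  by rewrite phiM -[phi h]invrK Gdiv // GV0.
have GV g : g \in G -> exists2 h, h \in G & mu h g = e.
  move=> /phiG gG; have gV := GV0 _ gG; exists (psi (phi g)^-1).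
    by apply: GphiG; rewrite psiK // GO.
  by apply: phi_inj; rewrite phiM phie psiK ?GO // mulVr // Gunit.
have m0 : (0 < m)%N.
  rewrite lt0n; apply/eqP => m_eq0.
  have e0 : e = 0 by apply/matrixP => -[i im]; exfalso; move: im; rewrite m_eq0.
  by have := phie; rewrite e0 phi0 => /eqP; rewrite eq_sym oner_eq0.
rewrite /= -cardG mul2n -addnn.
have kpos : (0 : R) < #|` G|%fset%:R.
  by rewrite ltr0n cardfs_gt0; apply/fset0Pn; exists e.
have mm0 : (0 < m + m)%N by rewrite addn_gt0 m0.
(* A ball of volume exactly [#|G|]; halving its radius gives the factor [2 ^- d]. *)
have [r r0 vE] := exists_ball_volume mm0 kpos.
have [M [Mt M1 short]] :=
  exists_generator_without_short_vector muBr muBl muA mu_eq0 m0 eG mue GM GV r0 vE.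
split; last exact: (c_const_of_generator_matrix Mt M1 r0 vE short).
have := lattice_packing_of_generator_matrix Mt M1 r0 vE short.
by move=> packing; do 2 eexists; exact: packing.
Qed.
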